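(* Let $G$ and $H$ be graphs with $\mathrm{oh}(G)=s\geq 2$ and $\mathrm{oh}(H)=t\geq 2$. Then $\mathrm{oh}(G\square H)\geq s+t-2$.
   Context: All graphs are finite, simple and loopless. $\mathrm{oh}(G)$ (Odd Hadwiger number) is the largest integer $m$ for which there exist $m$ pairwise vertex-disjoint trees $Z_1,\dots,Z_m$ in $G$ and a 2-colouring $c$ of $V(Z_1)\cup\dots\cup V(Z_m)$ that is proper on each $Z_k$, such that for every $k\neq k'$ there is an edge $xy\in E(G)$ with $x\in V(Z_k)$, $y\in V(Z_{k'})$, $c(x)=c(y)$. The Cartesian product $G\square H$ has vertex set $V(G)\times V(H)$, with $(v_1,u_1)\sim(v_2,u_2)$ iff ($v_1=v_2$ and $u_1u_2\in E(H)$) or ($u_1=u_2$ and $v_1v_2\in E(G)$). *)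

(* Defs.v *)
From mathcomp Require Import all_boot.
From mathcomp Require Import boolp.

Set Implicit Arguments.
Unset Strict Implicit.
Unset Printing Implicit Defensive.

Record sgraph := SGraph {
  vertex :> finType;
  edge : rel vertex;
  edge_sym : symmetric edge;
  edge_irrefl : irreflexive edge }.

Record subgraph (G : sgraph) := Subgraph {
  sub_verts : {set G};
  sub_edge : rel G;
  sub_edge_sym : symmetric sub_edge;
  sub_edge_edge : subrel sub_edge (@edge G);
  sub_edge_verts : forall x y, sub_edge x y -> x \in sub_verts }.

(* Subgraphs need not be induced. Since the edges of Z have both ends in
   sub_verts Z, connection by sub_edge Z is connection inside Z. The bound
   [2 < size p] excludes the degenerate cycles [::] and [:: x; y]. *)
Definition is_tree (G : sgraph) (Z : subgraph G) : Prop :=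
  [/\ sub_verts Z != set0,
      {in sub_verts Z &, forall x y, connect (sub_edge Z) x y} &
      forall p : seq G, 2 < size p -> ~~ ucycleb (sub_edge Z) p].

(* The colouring c is total on G; only its values on the trees matter. *)
Definition odd_clique_model (G : sgraph) (m : nat)
    (Z : 'I_m -> subgraph G) (c : G -> bool) : Prop :=
  [/\ forall k, is_tree (Z k),
      forall k k', k != k' -> [disjoint sub_verts (Z k) & sub_verts (Z k')],
      forall k x y, sub_edge (Z k) x y -> c x != c y &
      forall k k', k != k' -> exists x y,
        [/\ edge x y, x \in sub_verts (Z k), y \in sub_verts (Z k')
          & c x = c y]].

Definition has_odd_clique_model (G : sgraph) (m : nat) : Prop :=
  exists (Z : 'I_m -> subgraph G) (c : G -> bool), odd_clique_model Z c.

Lemma has_odd_clique_model0 (G : sgraph) :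
  exists m, `[< has_odd_clique_model G m >].
Proof.
exists 0; apply/asboolP.
have Z : 'I_0 -> subgraph G by case.
by exists Z, (fun=> false); split; case.
Qed.

Lemma has_odd_clique_model_bound (G : sgraph) (m : nat) :
  `[< has_odd_clique_model G m >] -> m <= #|G|.
Proof.
move=> /asboolP[Z [c [treeZ disjZ _ _]]].
have rootP k : exists x, x \in sub_verts (Z k).
  by have [/set0Pn] := treeZ k.
pose root k := xchoose (rootP k).
have root_inj : injective root.
  move=> k k' eq_root; apply/eqP/negPn/negP => /disjZ /pred0P /(_ (root k)) /=.
  by rewrite {2}eq_root !(xchooseP (rootP _)).
by rewrite -[m]card_ord; exact: leq_card root_inj.
Qed.

Definition oh (G : sgraph) : nat :=
  ex_maxn (has_odd_clique_model0 G) (@has_odd_clique_model_bound G).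

Section CartesianProduct.
Variables G H : sgraph.

Definition cart_edge : rel (G * H) := fun p q =>
  (p.1 == q.1) && edge p.2 q.2 || (p.2 == q.2) && edge p.1 q.1.

Lemma cart_edge_sym : symmetric cart_edge.
Proof.
move=> p q; rewrite /cart_edge eq_sym [p.2 == _]eq_sym.
by rewrite edge_sym [edge p.1 _]edge_sym.
Qed.

Lemma cart_edge_irrefl : irreflexive cart_edge.
Proof. by move=> p; rewrite /cart_edge !edge_irrefl !andbF. Qed.

Definition cart_prod : sgraph := SGraph cart_edge_sym cart_edge_irrefl.

End CartesianProduct.

(* Main.v *)
Require Import Defs.
From mathcomp Require Import all_boot.
From mathcomp Require Import boolp.

(* The trees of a model may be replaced by vertex sets that are connected
   through bichromatic edges.  Let Z_1, ..., Z_s with colouring c and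
   W_1, ..., W_t with colouring d be models in G and H.  Flipping the colour of
   one member of a model turns its monochromatic links into bichromatic ones:
   so T = Z_{s-1} \cup Z_s is connected for the colouring c' obtained by
   flipping c on Z_s, and U = W_1 \cup ... \cup W_t is connected for a flip d'
   of d.  The s + t - 2 sets are Z_i x U coloured by c + d' (i <= s - 2) and
   T x W_j coloured by c' + d.  For h in W_j, both Z_{s-1} x {h} and Z_s x {h}
   have an edge to Z_i x {h} between vertices with equal first colour c; as c'
   agrees with c on one of Z_{s-1}, Z_s and is flipped on the other, exactly one
   of these two edges is monochromatic in the product, whatever d' is. *)

Set Implicit Arguments.
Unset Strict Implicit.
Unset Printing Implicit Defensive.

(** * Bichromatic connectivity and monochromatic links *)

Definition bichrom_edge (G : sgraph) (S : {set G}) (c : G -> bool) : rel G :=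
  fun x y => [&& edge x y, x \in S, y \in S & c x != c y].

Definition bichrom_connected (G : sgraph) (S : {set G}) (c : G -> bool) : Prop :=
  S != set0 /\ {in S &, forall x y, connect (bichrom_edge S c) x y}.

(** Each side carries its own colouring, since the sets built in the product are coloured separately
    and glued only at the end. *)
Definition monochrom_linked (G : sgraph) (A : {set G}) (c : G -> bool)
    (B : {set G}) (d : G -> bool) : Prop :=
  exists x y, [/\ edge x y, x \in A, y \in B & c x = d y].

Lemma bichrom_edge_sym (G : sgraph) (S : {set G}) c :
  symmetric (bichrom_edge S c).
Proof.
move=> x y; rewrite /bichrom_edge edge_sym eq_sym.
by case: (x \in S); case: (y \in S).
Qed.

Lemma monochrom_linked_sym (G : sgraph) (A B : {set G}) c d :
  monochrom_linked A c B d -> monochrom_linked B d A c.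
Proof. by case=> x [y [exy xA yB cd]]; exists y, x; rewrite edge_sym. Qed.

(** * Spanning trees by breadth-first search *)

(** [depth x] is the length of a shortest path from [r] to [x], and [par x] is the last vertex
    before [x] on such a path. *)
Lemma connect_depth (T : finType) (e : rel T) (r : T) :
  exists (par : T -> T) (depth : T -> nat), forall x, connect e r x -> x != r ->
    [/\ e (par x) x, connect e r (par x) & depth (par x) < depth x].
Proof.
pose P x n := `[< exists p, [/\ path e r p, last r p = x & size p <= n] >].
(* The second disjunct gives unreachable vertices depth 0, so the minimum exists for every [x]. *)
have exP x : exists n, P x n || ~~ connect e r x.
  case cx: (connect e r x); last by exists 0; rewrite orbT.
  case/connectP: cx => p pp ->; exists (size p).
  by rewrite orbF; apply/asboolP; exists p.
pose depth x := ex_minn (exP x).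
have step x : exists y, connect e r x -> x != r ->
    [/\ e y x, connect e r y & depth y < depth x].
  case cx: (connect e r x); last by exists x.
  have [p [pp lp sp]] : exists p, [/\ path e r p, last r p = x & size p <= depth x].
    by rewrite /depth; case: ex_minnP => n; rewrite cx orbF => /asboolP.
  case/lastP: p pp lp sp => [|q z]; first by move=> _ <- _; exists r; rewrite eqxx.
  rewrite rcons_path last_rcons size_rcons => /andP[pq eqz] zx sq.
  rewrite {z}zx in eqz; exists (last r q) => _ _; split => //.
    by apply/connectP; exists q.
  apply: leq_ltn_trans sq; rewrite /depth; case: ex_minnP => m _; apply.
  by apply/orP; left; apply/asboolP; exists q.
have [par parP] := choice step.
by exists par, depth.
Qed.

(** Both cycle neighbours of a vertex of maximal depth would be its parent, hence equal, which a
    duplicate-free cycle of length at least 3 forbids. *)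
Lemma rank_acyclic (T : eqType) (e : rel T) (par : T -> T) (depth : T -> nat) :
  (forall x y, e x y -> (par x = y /\ depth y < depth x) \/
                        (par y = x /\ depth x < depth y)) ->
  forall p : seq T, 2 < size p -> ~~ ucycleb e p.
Proof.
move=> eP p sp; apply/negP => /andP[cp up].
have [x xp maxx] : exists2 x, x \in p & {in p, forall y, depth y <= depth x}.
  have: 0 < size p by case: p sp {cp up}.
  elim: p {sp cp up} => // a p IH _; case: p IH => [|b p] IH.
    by exists a; rewrite ?inE // => y; rewrite inE => /eqP ->.
  have [//|x xp maxx] := IH.
  have [xa|ax] := leqP (depth x) (depth a).
    exists a; rewrite ?mem_head // => y; rewrite in_cons => /predU1P[-> //|/maxx yx].
    exact: leq_trans yx xa.
  exists x => [|y]; first by rewrite in_cons xp orbT.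
  by rewrite in_cons => /predU1P[->|/maxx //]; exact: ltnW.
(* After rotation the deepest vertex [x] comes first, so its neighbours are the second and the last
   entries. *)
have [i q rq] := rot_to xp.
move: sp up cp; rewrite -(size_rot i) -(rot_uniq i) -(rot_cycle i) rq.
have {}maxx y : y \in q -> depth y <= depth x.
  by move=> yq; apply: maxx; rewrite -(mem_rot i) rq inE yq orbT.
case: q maxx {rq} => // a q; case/lastP: q => // q b maxx _.
rewrite /= !rcons_path last_rcons => /and3P[_ ab _] /and3P[exa _ ebx].
have ma := maxx a (mem_head _ _).
have mb : depth b <= depth x by apply: maxx; rewrite inE mem_rcons mem_head orbT.
case: (eP _ _ exa) => -[pa da]; last by rewrite ltnNge ma in da.
case: (eP _ _ ebx) => -[pb db]; first by rewrite ltnNge mb in db.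
by rewrite -pa pb mem_rcons mem_head in ab.
Qed.

(** The edges from each non-root vertex to its parent form the tree: depth excludes cycles, and
    induction on depth leads every vertex to the root. *)
Lemma spanning_tree (G : sgraph) (S : {set G}) c : bichrom_connected S c ->
  exists Z : subgraph G, [/\ is_tree Z, sub_verts Z = S
    & forall x y, sub_edge Z x y -> c x != c y].
Proof.
case=> S0 conS; have /set0Pn[r rS] := S0.
have [par [depth pdP]] := connect_depth (bichrom_edge S c) r.
pose up x y := [&& x \in S, x != r & par x == y].
pose f : rel G := fun x y => up x y || up y x.
have upP x y : up x y ->
    [/\ bichrom_edge S c x y, par x = y & depth y < depth x].
  case/and3P=> xS xr /eqP <-.
  have [e1 _ dx] := pdP x (conS _ _ rS xS) xr.
  by split; rewrite // bichrom_edge_sym.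
have fsym : symmetric f by move=> x y; rewrite /f orbC.
have fsub x y : f x y -> bichrom_edge S c x y.
  by case/orP=> /upP[] //; rewrite bichrom_edge_sym.
have fedge : subrel f (@edge G) by move=> x y /fsub /and4P[].
have fS x y : f x y -> x \in S by move=> /fsub /and4P[].
exists (Subgraph fsym fedge fS); split=> //=; last by move=> x y /fsub /and4P[].
split=> //=; last first.
  apply: (@rank_acyclic _ _ par depth) => x y.
  by case/orP=> /upP[_ -> ->]; [left | right].
have to_root x : x \in S -> connect f x r.
  have [n] := ubnP (depth x); elim: n x => // n IH x dx xS.
  have [->|xr] := eqVneq x r; first exact: connect0.
  have fx : up x (par x) by rewrite /up xS xr eqxx.
  have [/and4P[_ _ pS _] _ dp] := upP _ _ fx.
  apply: (@connect_trans _ _ (par x)); first by apply: connect1; rewrite /f fx.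
  by apply: IH => //; apply: leq_trans dp _.
move=> x y xS yS; apply: connect_trans (to_root x xS) _.
by rewrite (sym_connect_sym fsym); exact: to_root.
Qed.

(** * Passing between trees and coloured vertex sets *)

Lemma tree_bichrom_connected (G : sgraph) (Z : subgraph G) c :
  is_tree Z -> (forall x y, sub_edge Z x y -> c x != c y) ->
  bichrom_connected (sub_verts Z) c.
Proof.
case=> Z0 conZ _ cZ; split=> // x y xZ yZ.
apply: connect_sub (conZ x y xZ yZ) => u v uv; apply: connect1.
rewrite /bichrom_edge (sub_edge_edge uv) (sub_edge_verts uv) cZ //.
by rewrite (@sub_edge_verts _ Z v u) // sub_edge_sym.
Qed.

Lemma eq_bichrom_connected (G : sgraph) (S : {set G}) c d :
  {in S, c =1 d} -> bichrom_connected S c -> bichrom_connected S d.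
Proof.
move=> cd [S0 conS]; split=> // x y xS yS.
rewrite (@eq_connect _ _ (bichrom_edge S c)) ?conS // => u v.
rewrite /bichrom_edge; case uS: (u \in S); case vS: (v \in S); rewrite ?andbF //.
by rewrite !cd.
Qed.

(** Disjointness allows the separate colourings to be glued into one; each set is then replaced by a
    spanning tree. An arbitrary finite index type leaves room for a disjoint sum of two families. *)
Lemma has_odd_clique_model_of_sets (G : sgraph) (I : finType)
    (S : I -> {set G}) (c : I -> G -> bool) :
  (forall i, bichrom_connected (S i) (c i)) ->
  (forall i j, i != j -> [disjoint S i & S j]) ->
  (forall i j, i != j -> monochrom_linked (S i) (c i) (S j) (c j)) ->
  has_odd_clique_model G #|I|.
Proof.
move=> conS disS linkS.
pose col x := if [pick i | x \in S i] is Some i then c i x else false.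
have colE i : {in S i, c i =1 col}.
  move=> x xi; rewrite /col; case: pickP => [j xj|/(_ i)]; last by rewrite xi.
  have [-> //|/disS /pred0P/(_ x)] := eqVneq i j.
  by rewrite /= xi xj.
have [Z ZP] := choice (fun i => spanning_tree (eq_bichrom_connected (@colE i) (conS i))).
exists (fun k => Z (enum_val k)), col; split.
- by move=> k; case: (ZP (enum_val k)).
- move=> k k' kk'; have [_ -> _] := ZP (enum_val k); have [_ -> _] := ZP (enum_val k').
  by apply: disS; rewrite (inj_eq enum_val_inj).
- by move=> k; case: (ZP (enum_val k)).
move=> k k' kk'; have [_ -> _] := ZP (enum_val k); have [_ -> _] := ZP (enum_val k').
have [|x [y [exy xS yS cxy]]] := linkS (enum_val k) (enum_val k').
  by rewrite (inj_eq enum_val_inj).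
by exists x, y; split=> //; rewrite -(colE _ x xS) -(colE _ y yS).
Qed.

(** * Connected sets in products and unions *)

(** A product edge moves one coordinate, so under the sum colouring it is bichromatic exactly when
    the moved edge is. Paths move first in [S], then in [T]. *)
Lemma bichrom_connected_cart (G H : sgraph) (S : {set G}) (T : {set H}) c d :
  bichrom_connected S c -> bichrom_connected T d ->
  @bichrom_connected (cart_prod G H) (setX S T)
    (fun p : G * H => c p.1 (+) d p.2).
Proof.
move=> [/set0Pn[x0 x0S] conS] [/set0Pn[y0 y0T] conT]; split.
  by apply/set0Pn; exists (x0, y0); rewrite inE /= x0S.
set e := bichrom_edge _ _.
have hor x x' y : y \in T -> connect (bichrom_edge S c) x x' ->
    connect e (x, y) (x', y).
  move=> yT /connectP[p pp ->]; elim: p x pp => //= z p IH x /andP[exz /IH].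
  apply: connect_trans; apply: connect1.
  case/and4P: exz => exz xS zS cxz.
  rewrite /e /bichrom_edge /= /cart_edge !inE /= eqxx exz xS zS yT orbT /=.
  by apply: contra cxz => /eqP /addIb ->.
have ver x y y' : x \in S -> connect (bichrom_edge T d) y y' ->
    connect e (x, y) (x, y').
  move=> xS /connectP[p pp ->]; elim: p y pp => //= z p IH y /andP[eyz /IH].
  apply: connect_trans; apply: connect1.
  case/and4P: eyz => eyz yT zT dyz.
  rewrite /e /bichrom_edge /= /cart_edge !inE /= eqxx eyz xS zT yT /=.
  by apply: contra dyz => /eqP /addbI ->.
move=> [x y] [x' y']; rewrite !inE /= => /andP[xS yT] /andP[x'S y'T].
by apply: (connect_trans (hor x x' y yT (conS _ _ _ _))) => //; apply: ver; auto.
Qed.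

(** [S k] is the centre of a star: the flip makes a link from each other [S i] to [S k]
    bichromatic. *)
Lemma bichrom_connected_star (G : sgraph) (I : finType) (S : I -> {set G}) c
    (D : {set I}) (k : I) : k \in D ->
  (forall i, bichrom_connected (S i) c) ->
  (forall i j, i != j -> [disjoint S i & S j]) ->
  (forall i j, i != j -> monochrom_linked (S i) c (S j) c) ->
  bichrom_connected (\bigcup_(i in D) S i) (fun x => c x (+) (x \in S k)).
Proof.
move=> kD conS disS linkS.
have outk i x : i != k -> x \in S i -> (x \in S k) = false.
  by move=> /disS /pred0P/(_ x) /= + xi; rewrite xi.
set U := \bigcup_(i in D) S i; pose e := bichrom_edge U (fun x => c x (+) (x \in S k)).
have sU i x : i \in D -> x \in S i -> x \in U.
  by move=> iD xi; apply/bigcupP; exists i.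
have inside i x y : i \in D -> x \in S i -> y \in S i -> connect e x y.
  move=> iD xi yi; have [_ /(_ x y xi yi)] := conS i.
  apply: connect_sub => u v /and4P[euv ui vi cuv]; apply: connect1.
  rewrite /e /bichrom_edge euv !(sU i) //=.
  (* The flip is constant on [S i], so edges inside [S i] stay bichromatic. *)
  have -> : (u \in S k) = (v \in S k).
    by have [<-|ik] := eqVneq i k; [rewrite ui vi | rewrite !(outk i)].
  by apply: contra cuv => /eqP /addIb ->.
have esym : connect_sym e by apply: sym_connect_sym; exact: bichrom_edge_sym.
have [/set0Pn[r rk] _] := conS k.
have to_root x : x \in U -> connect e x r.
  case/bigcupP=> i iD xi.
  have [ik|ik] := eqVneq i k; first by apply: (inside k) => //; rewrite -ik.
  have [u [v [euv ui vk cuv]]] := linkS i k ik.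
  apply: connect_trans (inside i _ _ iD xi ui) _.
  apply: connect_trans (inside k _ _ kD vk rk); apply: connect1.
  rewrite /e /bichrom_edge euv (sU i u) // (sU k v) //= (outk i u) // vk cuv.
  by case: (c v).
split; first by apply/set0Pn; exists r; exact: sU rk.
move=> x y xU yU; apply: connect_trans (to_root x xU) _.
by rewrite esym; exact: to_root.
Qed.

(** * The model in the Cartesian product *)

Lemma oh_model (G : sgraph) : has_odd_clique_model G (oh G).
Proof. by rewrite /oh; case: ex_maxnP => m /asboolP. Qed.

Lemma oh_max (G : sgraph) m : has_odd_clique_model G m -> m <= oh G.
Proof. by move=> Gm; rewrite /oh; case: ex_maxnP => n _; apply; apply/asboolP. Qed.

(** An edge of [G] is copied into the layer of [h]; [b] is the discrepancy of [d] and [d'] at [h],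
    which the first colours must compensate. *)
Lemma monochrom_linked_cart_l (G H : sgraph) (A B : {set G}) (T U : {set H})
    c c' d d' (h : H) (b : bool) :
  h \in T -> h \in U -> d h = d' h (+) b ->
  monochrom_linked A c B (fun x => c' x (+) b) ->
  @monochrom_linked (cart_prod G H) (setX A T) (fun p : G * H => c p.1 (+) d p.2)
    (setX B U) (fun p : G * H => c' p.1 (+) d' p.2).
Proof.
move=> hT hU dh [x [y [exy xA yB cxy]]]; exists (x, h), (y, h).
rewrite !inE /= xA yB hT hU; split=> //; first by rewrite /cart_edge /= eqxx exy orbT.
by rewrite cxy dh; case: (c' y) (d' h) b {cxy dh} => [] [] [].
Qed.

Lemma monochrom_linked_cart_r (G H : sgraph) (A : {set G}) (T U : {set H})
    c d d' :
  A != set0 -> monochrom_linked T d U d' ->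
  @monochrom_linked (cart_prod G H) (setX A T) (fun p : G * H => c p.1 (+) d p.2)
    (setX A U) (fun p : G * H => c p.1 (+) d' p.2).
Proof.
move=> /set0Pn[g gA] [x [y [exy xT yU dxy]]]; exists (g, x), (g, y).
rewrite !inE /= gA xT yU; split=> //; first by rewrite /cart_edge /= eqxx exy.
by rewrite dxy.
Qed.

Lemma has_odd_clique_model_cart (G H : sgraph) (s t : nat) :
  2 <= s -> 1 <= t -> has_odd_clique_model G s -> has_odd_clique_model H t ->
  has_odd_clique_model (cart_prod G H) (s + t - 2).
Proof.
move=> s2 t1 [Z [c [treeZ disZ cZ linkZ]]] [W [d [treeW disW dW linkW]]].
(* [k0] and [k1] index the two members merged into [T]; the flips occur on [Z k0] and on [W l0]. *)
pose k0 := Ordinal (ltnW s2); pose k1 := Ordinal s2; pose l0 := Ordinal t1.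
have k01 : k1 != k0 by [].
have conZ i := tree_bichrom_connected (treeZ i) (@cZ i).
have conW j := tree_bichrom_connected (treeW j) (@dW j).
pose D := [set k0; k1].
pose T := \bigcup_(i in D) sub_verts (Z i).
pose U := \bigcup_(j in [set: 'I_t]) sub_verts (W j).
pose c' x := c x (+) (x \in sub_verts (Z k0)).
pose d' x := d x (+) (x \in sub_verts (W l0)).
have conT : bichrom_connected T c' by apply: bichrom_connected_star; rewrite ?set21.
have conU : bichrom_connected U d' by apply: bichrom_connected_star; rewrite ?inE.
have WU j h : h \in sub_verts (W j) -> h \in U.
  by move=> hj; apply/bigcupP; exists j; rewrite ?inE.
(* On [Z k1] the colourings [c'] and [c] agree, which serves [b = false]; on [Z k0] they are
   opposite, which serves [b = true]. *)
have linkT i b : i \notin D -> monochrom_linked (sub_verts (Z i)) c T (fun x => c' x (+) b).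
  rewrite !inE negb_or => /andP[i0 i1].
  have [x [y [exy xi yk cxy]]] := linkZ i (if b then k0 else k1) (ltac:(by case: b)).
  exists x, y; split=> //.
    by apply/bigcupP; exists (if b then k0 else k1) => //; case: (b); rewrite !inE eqxx ?orbT.
  rewrite cxy /c'; case: b yk => [-> | yk]; first by rewrite addbK.
  by have /pred0P/(_ y) /= := disZ _ _ k01; rewrite yk /= => ->; rewrite !addbF.
have disT i : i \notin D -> [disjoint sub_verts (Z i) & T].
  move=> iD; apply/pred0P => x /=; apply/andP => -[xi /bigcupP[k kD xk]].
  have ik : i != k by apply: contraNneq iD => ->.
  by have /pred0P/(_ x) /= := disZ _ _ ik; rewrite xi xk.
pose I := ({i : 'I_s | i \notin D} + 'I_t)%type.
pose V (x : I) : {set cart_prod G H} := match x with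
  | inl i => setX (sub_verts (Z (val i))) U
  | inr j => setX T (sub_verts (W j)) end.
pose col (x : I) : cart_prod G H -> bool := match x with
  | inl i => fun p : G * H => c p.1 (+) d' p.2
  | inr j => fun p : G * H => c' p.1 (+) d p.2 end.
have disX (A B : {set G}) (A' B' : {set H}) : [disjoint A & B] || [disjoint A' & B'] ->
    [disjoint setX A A' & setX B B'].
  move=> dis; apply/pred0P => -[x y]; rewrite /= !inE /=.
  case/orP: dis => /pred0P; [move=> /(_ x)|move=> /(_ y)] => /=; do 4 case: (_ \in _) => //.
(* At a point [h] of [W j], the colourings [d'] and [d] differ exactly when [h] lies in [W l0]; this
   is the discrepancy passed to [linkT]. *)
have linkIJ (i : {i : 'I_s | i \notin D}) (j : 'I_t) :
    monochrom_linked (V (inl i)) (col (inl i)) (V (inr j)) (col (inr j)).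
  have [/set0Pn[h hj] _] := conW j.
  by apply: (@monochrom_linked_cart_l _ _ _ _ _ _ _ _ _ _ h
    (h \in sub_verts (W l0))) (WU _ _ hj) hj _ (linkT _ _ (valP i)).
(* As [k0] and [k1] are distinct, the complement of [D] has [s - 2] elements. *)
have -> : s + t - 2 = #|{: I}|.
  have : #|D| + #|[predC D]| = s by rewrite cardC card_ord.
  rewrite cards2 eq_sym k01 card_sum card_sig card_ord => sE.
  by rewrite -[in LHS]sE -addnA addKn; congr (_ + _); apply: eq_card.
apply: (@has_odd_clique_model_of_sets _ _ V col).
- by case=> [i|j]; apply: bichrom_connected_cart.
- case=> [i|j] [i'|j'] ij; apply: disX.
  + by rewrite disZ.
  + by rewrite disT ?(valP i).
  + by rewrite disjoint_sym disT ?(valP i').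
  by rewrite disW ?orbT.
(* Within one family, a link of the factor is copied over a point of the common set, [U] or [T],
   where both colourings agree. *)
case=> [i|j] [i'|j'] ij.
- have [/set0Pn[h hU] _] := conU.
  apply: (@monochrom_linked_cart_l _ _ _ _ _ _ _ _ _ _ h false) => //.
    by rewrite addbF.
  have [x [y [exy xi yi cxy]]] := linkZ _ _ (ij : val i != val i').
  by exists x, y; rewrite addbF.
- exact: linkIJ.
- by apply: monochrom_linked_sym; exact: linkIJ.
apply: monochrom_linked_cart_r; first by case: conT.
exact: linkW.
Qed.

Theorem theorem2 (G H : sgraph) (s t : nat)
    (hG : oh G = s) (hs : 2 <= s) (hH : oh H = t) (ht : 2 <= t) :
  s + t - 2 <= oh (cart_prod G H).
Proof.
apply: oh_max; apply: has_odd_clique_model_cart => //; first exact: ltnW.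
  by rewrite -hG; exact: oh_model.
by rewrite -hH; exact: oh_model.
Qed.
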